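(* If $P$ is parallel on a PTR-submanifold $M$, tangent to $\xi$, of a Sasakian manifold, then $P=0$ on $TM\cap\ker\eta$. Consequently a proper PTR-submanifold cannot have parallel $P$.
   Context: A Sasakian manifold $(\overline M^{2m+1},\phi,\xi,\eta,g)$ consists of a Riemannian metric $g$ with Levi-Civita connection $\widetilde\nabla$, a $(1,1)$-tensor field $\phi$, a vector field $\xi$ (the Reeb field) and a 1-form $\eta$ with $\phi^2X=-X+\eta(X)\xi$, $\eta(\xi)=1$, $\phi\xi=0$, $g(\phi X,\phi Y)=g(X,Y)-\eta(X)\eta(Y)$ and $(\widetilde\nabla_X\phi)Y=g(X,Y)\xi-\eta(Y)X$; in particular $\widetilde\nabla_X\xi=-\phi X$. Let $M$ be an immersed submanifold with $\xi\in\Gamma(TM)$ and induced Levi-Civita connection $\nabla$. For $X\in TM$ write $\phi X=PX+FX$ with $PX$ tangent and $FX$ normal. Define $(\bar\nabla_XP)Y=\nabla_X(PY)-P\nabla_XY$; $P$ is parallel if $\bar\nabla P=0$. A PTR (partially totally real) submanifold is such an $M$ with a chosen nonzero constant-rank distribution $\mathcal D^{\perp}\subset TM\cap\ker\eta$ satisfying $\phi\mathcal D^{\perp}\subset T^{\perp}M$. The ambiguous distribution $\widetilde{\mathcal D}$ is the orthogonal complement of $\mathcal D^{\perp}\oplus\langle\xi\rangle$ in $TM$. On an open region where the geometric type of $\widetilde{\mathcal D}$ is constant, the PTR structure is called proper if $\widetilde{\mathcal D}$ is neither totally real ($\phi\widetilde{\mathcal D}\subset T^\perp M$) nor $\phi$-invariant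 ($\phi\widetilde{\mathcal D}=\widetilde{\mathcal D}$), and is neither slant nor pointwise slant. A distribution $D\subset TM\cap\ker\eta$ is pointwise slant if for each point $p$ the angle between $\phi X$ and $D_p$ is the same for all nonzero $X\in D_p$, and slant if this angle is moreover independent of $p$. *)

(* Defs.v *)
From HB Require Import structures.
From mathcomp Require Import all_boot all_order all_algebra.
From mathcomp Require Import all_classical all_reals all_analysis.
Set Implicit Arguments.
Unset Strict Implicit.
Unset Printing Implicit Defensive.
Import Order.TTheory GRing.Theory Num.Theory numFieldNormedType.Exports.
Local Open Scope classical_set_scope.
Local Open Scope ring_scope.

(* Requiring Frechet differentiability together with the regularity of the
   directional derivatives makes this the usual class C^k. *)
Fixpoint Ck (R : realType) (V W : normedModType R) (k : nat) (U : set V)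
    (f : V -> W) : Prop :=
  if k is k'.+1 then
    (forall x, U x -> differentiable f x) /\
    (forall v, Ck k' U (fun x => 'D_v f x))
  else forall x, U x -> {for x, continuous f}.

Definition smooth_in (R : realType) (V W : normedModType R) (U : set V)
    (f : V -> W) : Prop :=
  forall k, Ck k U f.

Definition smooth_near (R : realType) (V W : normedModType R) (x : V)
    (f : V -> W) : Prop :=
  exists U, open_nbhs x U /\ smooth_in U f.

Record chart (R : realType) (n : nat) (T : topologicalType) := Chart {
  dom : set T;
  coord : T -> 'rV[R]_n;
  coordV : 'rV[R]_n -> T;
  dom_open : open dom;
  image_open : open (coord @` dom);
  coordK : forall p, dom p -> coordV (coord p) = p;
  coord_cont : forall p, dom p -> {for p, continuous coord};
  coordV_cont : forall x, (coord @` dom) x -> {for x, continuous coordV}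
}.

Record manifold (R : realType) (n : nat) := Manifold {
  points :> topologicalType;
  points_hausdorff : hausdorff_space points;
  points_countable : @second_countable points;
  atlas : set (chart R n points);
  atlas_cover : forall p, exists2 c, atlas c & dom c p;
  atlas_compat : forall c d, atlas c -> atlas d ->
    smooth_in (coord c @` (dom c `&` dom d)) (coord d \o coordV c)
}.

Section Manifolds.
Context (R : realType) (n : nat) (M : manifold R n).

Definition smooth_at (p : M) (f : M -> R) : Prop :=
  forall c, atlas c -> dom c p ->
    smooth_near (coord c p) (f \o coordV c : 'rV[R]_n -> R^o).

Definition smooth_fun (U : set M) (f : M -> R) : Prop :=
  forall p, U p -> smooth_at p f.

Definition smooth_curve (gamma : R -> M) : Prop :=
  forall c, atlas c -> dom c (gamma 0) ->
    exists W : set R^o, [/\ open_nbhs (0 : R^o) W,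
      gamma @` W `<=` dom c &
      smooth_in W (coord c \o gamma : R^o -> 'rV[R]_n)].

(* Tangent vectors at p are operators on the functions smooth near p.  They are
   represented by operators on all functions, with the value 0 on the functions
   that are not smooth near p, so that equality of operators is equality of
   tangent vectors; [at_point] imposes this convention. *)
Local Notation operator := ((M -> R) -> R^o).

Definition at_point (p : M) (D : operator) : operator :=
  fun f => if `[< smooth_at p f >] then D f else 0.

Definition velocity (gamma : R -> M) : operator :=
  at_point (gamma 0) (fun f => derive1 (f \o gamma : R -> R^o) 0).

Definition tangent (p : M) : set operator :=
  [set v | exists gamma : R -> M,
     [/\ gamma 0 = p, smooth_curve gamma & v = velocity gamma]].

(* Fields are total functions, of which only the values on U matter. *)
Definition vector_field (U : set M) (X : M -> operator) : Prop :=
  forall p, U p -> tangent p (X p) /\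
    forall f, smooth_at p f -> smooth_at p (fun q => X q f).

Definition lie_bracket (X Y : M -> operator) (p : M) : operator :=
  at_point p (fun f => X p (fun q => Y q f) - Y p (fun q => X q f)).

Definition one_form (eta : M -> operator -> R) : Prop :=
  (forall p a u v, tangent p u -> tangent p v ->
     eta p (a *: u + v) = a * eta p u + eta p v) /\
  (forall U X, open U -> vector_field U X ->
     smooth_fun U (fun p => eta p (X p))).

Definition tensor11 (phi : M -> operator -> operator) : Prop :=
  [/\ forall p u, tangent p u -> tangent p (phi p u),
      forall p a u v, tangent p u -> tangent p v ->
        phi p (a *: u + v) = a *: phi p u + phi p v &
      forall U X, open U -> vector_field U X ->
        vector_field U (fun p => phi p (X p))].

Definition riemannian_metric (g : M -> operator -> operator -> R) : Prop :=
  [/\ forall p u v, tangent p u -> tangent p v -> g p u v = g p v u,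
      forall p a u v w, tangent p u -> tangent p v -> tangent p w ->
        g p (a *: u + v) w = a * g p u w + g p v w,
      forall p u, tangent p u -> u <> 0 -> 0 < g p u u &
      forall U X Y, open U -> vector_field U X -> vector_field U Y ->
        smooth_fun U (fun p => g p (X p) (Y p))].

(* The connection acts on the vector fields defined on an arbitrary open set;
   by [conn_local] it only depends on their values on that set. *)
Record connection (nabla : (M -> operator) -> (M -> operator) -> M -> operator)
    : Prop := Connection {
  conn_field : forall U X Y, open U -> vector_field U X -> vector_field U Y ->
    vector_field U (nabla X Y);
  conn_local : forall U X X' Y Y', open U ->
    vector_field U X -> vector_field U Y ->
    (forall p, U p -> X p = X' p) -> (forall p, U p -> Y p = Y' p) ->
    forall p, U p -> nabla X Y p = nabla X' Y' p;
  conn_addl : forall U X X' Y p, open U -> vector_field U X ->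
    vector_field U X' -> vector_field U Y -> U p ->
    nabla (fun q => X q + X' q) Y p = nabla X Y p + nabla X' Y p;
  conn_scalel : forall U f X Y p, open U -> smooth_fun U f ->
    vector_field U X -> vector_field U Y -> U p ->
    nabla (fun q => f q *: X q) Y p = f p *: nabla X Y p;
  conn_addr : forall U X Y Y' p, open U -> vector_field U X ->
    vector_field U Y -> vector_field U Y' -> U p ->
    nabla X (fun q => Y q + Y' q) p = nabla X Y p + nabla X Y' p;
  conn_leibniz : forall U f X Y p, open U -> smooth_fun U f ->
    vector_field U X -> vector_field U Y -> U p ->
    nabla X (fun q => f q *: Y q) p = X p f *: Y p + f p *: nabla X Y p
}.

Record levi_civita (g : M -> operator -> operator -> R)
    (nabla : (M -> operator) -> (M -> operator) -> M -> operator)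
    : Prop := LeviCivita {
  lc_connection : connection nabla;
  lc_torsion_free : forall U X Y p, open U ->
    vector_field U X -> vector_field U Y -> U p ->
    nabla X Y p - nabla Y X p = lie_bracket X Y p;
  lc_metric : forall U X Y Z p, open U ->
    vector_field U X -> vector_field U Y -> vector_field U Z -> U p ->
    X p (fun q => g q (Y q) (Z q)) =
      g p (nabla X Y p) (Z p) + g p (Y p) (nabla X Z p)
}.

Definition cov_deriv11
    (nabla : (M -> operator) -> (M -> operator) -> M -> operator)
    (T : M -> operator -> operator) (X Y : M -> operator) (p : M) : operator :=
  nabla X (fun q => T q (Y q)) p - T p (nabla X Y p).

Definition distribution (r : nat) (D : M -> set operator) : Prop :=
  forall p, exists (U : set M) (X : 'I_r -> M -> operator),
    [/\ open_nbhs p U, forall j, vector_field U (X j) &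
     forall q, U q ->
       (forall a : 'I_r -> R, \sum_j a j *: X j q = 0 -> forall j, a j = 0) /\
       D q = [set v | exists a : 'I_r -> R, v = \sum_j a j *: X j q]].

Definition vec_angle (g : M -> operator -> operator -> R) (p : M)
    (u v : operator) : R :=
  acos (g p u v / (Num.sqrt (g p u u) * Num.sqrt (g p v v))).

(* The angle between a nonzero vector u and a nonzero subspace D is the least
   angle between u and a nonzero vector of D. *)
Definition subspace_angle (g : M -> operator -> operator -> R) (p : M)
    (u : operator) (D : set operator) : R :=
  inf [set vec_angle g p u v | v in [set v | D v /\ v <> 0]].

End Manifolds.

Local Notation operator R M := ((M -> R) -> R^o).

Definition smooth_map (R : realType) (k n : nat) (M : manifold R k)
    (N : manifold R n) (i : M -> N) : Prop :=
  continuous i /\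
  forall p c d, atlas c -> dom c p -> atlas d -> dom d (i p) ->
    smooth_near (coord c p) (coord d \o i \o coordV c).

Definition differential (R : realType) (k n : nat) (M : manifold R k)
    (N : manifold R n) (i : M -> N) (p : M) (v : operator R M)
    : operator R N :=
  at_point (i p) (fun f => v (f \o i)).

Definition immersion (R : realType) (k n : nat) (M : manifold R k)
    (N : manifold R n) (i : M -> N) : Prop :=
  smooth_map i /\
  forall p u v, tangent p u -> tangent p v ->
    differential i p u = differential i p v -> u = v.

Record sasakian (R : realType) (m : nat) := Sasakian {
  ambient :> manifold R (2 * m + 1)%N;
  phi : ambient -> operator R ambient -> operator R ambient;
  xi : ambient -> operator R ambient;
  eta : ambient -> operator R ambient -> R;
  metric : ambient -> operator R ambient -> operator R ambient -> R;
  nablaN : (ambient -> operator R ambient) ->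
    (ambient -> operator R ambient) -> ambient -> operator R ambient;
  metricP : riemannian_metric metric;
  nablaNP : levi_civita metric nablaN;
  phi_tensor : tensor11 phi;
  xi_field : vector_field setT xi;
  eta_form : one_form eta;
  phi_phi : forall p u, tangent p u -> phi p (phi p u) = - u + eta p u *: xi p;
  eta_xi : forall p, eta p (xi p) = 1;
  phi_xi : forall p, phi p (xi p) = 0;
  metric_phi : forall p u v, tangent p u -> tangent p v ->
    metric p (phi p u) (phi p v) = metric p u v - eta p u * eta p v;
  nabla_phi : forall U X Y p, open U ->
    vector_field U X -> vector_field U Y -> U p ->
    cov_deriv11 nablaN phi X Y p =
      metric p (X p) (Y p) *: xi p - eta p (Y p) *: X p
}.

Section Normal.
Context (R : realType) (m k : nat) (N : sasakian R m) (M : manifold R k).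
Context (i : M -> N).

Definition induced_metric (p : M) (u v : operator R M) : R :=
  metric (i p) (differential i p u) (differential i p v).

Definition normal (p : M) : set (operator R N) :=
  [set w | tangent (i p) w /\
     forall v, tangent p v -> metric (i p) w (differential i p v) = 0].

End Normal.

(* P and F are uniquely determined on tangent vectors by the last three fields,
   and nablaM on smooth fields by [nablaMP]. *)
Record submanifold (R : realType) (m : nat) (N : sasakian R m) (k : nat) :=
  Submanifold {
  base :> manifold R k;
  incl : base -> N;
  incl_immersion : immersion incl;
  (* xi is a section of TM: it is the image of a smooth field on the base *)
  xi_tangent : exists2 xiM : base -> operator R base,
    vector_field setT xiM &
    forall p, differential incl p (xiM p) = xi (incl p);
  nablaM : (base -> operator R base) -> (base -> operator R base) ->
    base -> operator R base;
  nablaMP : levi_civita (induced_metric incl) nablaM;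
  opP : base -> operator R base -> operator R base;
  opF : base -> operator R base -> operator R N;
  opP_tangent : forall p v, tangent p v -> tangent p (opP p v);
  opF_normal : forall p v, tangent p v -> normal incl p (opF p v);
  phi_split : forall p v, tangent p v ->
    phi (incl p) (differential incl p v) =
      differential incl p (opP p v) + opF p v
}.

Definition phiM (R : realType) (m : nat) (N : sasakian R m) (k : nat)
    (M : submanifold N k) (p : M) (v : operator R M) : operator R N :=
  phi (incl p) (differential (@incl _ _ _ _ M) p v).

Definition etaM (R : realType) (m : nat) (N : sasakian R m) (k : nat)
    (M : submanifold N k) (p : M) (v : operator R M) : R :=
  eta (incl p) (differential (@incl _ _ _ _ M) p v).

Record ptr_submanifold (R : realType) (m : nat) (N : sasakian R m) (k : nat) :=
  PTR {
  sub :> submanifold N k;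
  Dperp : sub -> set (operator R sub);
  Dperp_rank : nat;
  Dperp_rank_gt0 : (0 < Dperp_rank)%N;
  Dperp_distribution : distribution Dperp_rank Dperp;
  Dperp_eta : forall p v, Dperp p v -> etaM p v = 0;
  Dperp_phi : forall p v, Dperp p v -> normal (@incl _ _ _ _ sub) p (phiM p v)
}.

Section PTR.
Context (R : realType) (m : nat) (N : sasakian R m) (k : nat).
Context (M : ptr_submanifold N k).

Local Notation i := (@incl _ _ _ _ (sub M)).

Definition parallel_on (U : set M) : Prop :=
  forall W X Y p, open W -> W `<=` U ->
    vector_field W X -> vector_field W Y -> W p ->
    cov_deriv11 (@nablaM _ _ _ _ M) (@opP _ _ _ _ M) X Y p = 0.

Definition Dtilde (p : M) : set (operator R M) :=
  [set v | [/\ tangent p v,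
     forall w, Dperp p w -> induced_metric i p v w = 0 &
     metric (i p) (differential i p v) (xi (i p)) = 0]].

Definition totally_real_at (p : M) : Prop :=
  forall v, Dtilde p v -> normal i p (phiM p v).

Definition invariant_at (p : M) : Prop :=
  @phiM _ _ _ _ M p @` Dtilde p = differential i p @` Dtilde p.

(* the angle between phi v and Dtilde p, the latter viewed in the tangent space
   of the ambient manifold *)
Definition slant_angle (p : M) (v : operator R M) : R :=
  subspace_angle (@metric _ _ N) (i p) (phiM p v)
    (differential i p @` Dtilde p).

Definition pointwise_slant_at (p : M) : Prop :=
  forall v w, Dtilde p v -> v <> 0 -> Dtilde p w -> w <> 0 ->
    slant_angle p v = slant_angle p w.

Definition totally_real_on (U : set M) := forall p, U p -> totally_real_at p.

Definition invariant_on (U : set M) := forall p, U p -> invariant_at p.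

Definition pointwise_slant_on (U : set M) :=
  forall p, U p -> pointwise_slant_at p.

Definition slant_on (U : set M) :=
  exists theta : R, forall p v, U p -> Dtilde p v -> v <> 0 ->
    slant_angle p v = theta.

Definition constant_type_on (U : set M) : Prop :=
  forall p q, U p -> U q ->
    [/\ totally_real_at p <-> totally_real_at q,
        invariant_at p <-> invariant_at q &
        pointwise_slant_at p <-> pointwise_slant_at q].

Definition proper_on (U : set M) : Prop :=
  [/\ open U, constant_type_on U &
    [/\ ~ totally_real_on U, ~ invariant_on U,
        ~ slant_on U & ~ pointwise_slant_on U]].

End PTR.

(* Main.v *)
Require Import Defs.
From HB Require Import structures.
From mathcomp Require Import all_boot all_order all_algebra.
From mathcomp Require Import ring.
From mathcomp Require Import all_classical all_reals all_analysis.
Import Order.TTheory GRing.Theory Num.Theory numFieldNormedType.Exports.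
Local Open Scope classical_set_scope.
Local Open Scope ring_scope.

(** The endomorphism [P] is tested against the Reeb field.  It kills that field,
    so parallelism of [P], applied to it, says [P (nabla_X xi) = 0] for every
    field [X].

    On the other hand let [eta] also denote the restriction of the contact form
    to the submanifold.  Since the Levi-Civita connection is metric and
    torsion-free, [d eta (X, Y) = g (nabla_X xi, Y) - g (nabla_Y xi, X)]
    ([exterior_derivative_dual]).  The exterior derivative commutes with
    pullback ([exterior_derivative_pullback]), and on the ambient manifold
    [nabla_X xi = - phi X] gives [d eta (X, Y) = - 2 g (phi X, Y)]
    ([exterior_derivative_eta]).  Hence, on the submanifold,
    [g (nabla_X xi, Y) - g (nabla_Y xi, X) = - 2 g (P X, Y)]
    ([exterior_derivative_reeb]).

    For a tangent vector [z] let [X] and [Y] be fields extending [P z] and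
    [P (P z)].  As [P] is skew, [g (nabla_X xi, P (P z))] equals
    [- g (P (nabla_X xi), P z) = 0], and likewise [g (nabla_Y xi, P z) = 0].
    The formula therefore says [g (P (P z), P (P z)) = 0]; so [P (P z) = 0], and
    by skewness again [g (P z, P z) = - g (z, P (P z)) = 0], that is [P z = 0]
    ([parallel_opP0]).  In this way the induced connection is never compared
    with the ambient one through the second fundamental form: only the form
    [eta] passes from one manifold to the other.

    The argument is local, so [P] vanishes on every open set where it is
    parallel, and the structure is totally real there; this excludes proper
    structures.

    What precedes the geometry is the calculus that it takes for granted: the
    chain rule for maps of class C^k, and the identification of the velocities
    of curves with directional derivatives in a chart ([tangent_chartP]). *)

Local Notation coord := Defs.coord.
Local Notation lie_bracket := Defs.lie_bracket.

(** * Functions of class C^k *)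

Section Calculus.
Context {R : realType} {V : normedModType R}.

Lemma near_eq_differentiable {W : normedModType R} (f g : V -> W) (x : V) :
  {near x, f =1 g} -> differentiable f x -> differentiable g x.
Proof.
move=> fg df; have [cdf /eqaddoP ef] := (diff_locallyP x f).1 df.
have eg : g \o shift x = cst (g x) + 'd f x +o_ 0 id.
  apply/eqaddoP => e e0; have := ef e e0.
  have fgx : \forall h \near 0, f (h + x) = g (h + x).
    have : \forall y \near x, f y = g y by exact: fg.
    by rewrite (near_shift 0 x) subr0.
  apply: filterS2 fgx => h fgh.
  by rewrite /= !fctE /= fgh (nbhs_singleton fg).
apply/diff_locallyP; split; last by rewrite (diff_unique cdf eg).
by rewrite (diff_unique cdf eg).
Qed.

Lemma Ck_ext {W : normedModType R} k (U : set V) (f g : V -> W) :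
  open U -> (forall x, U x -> f x = g x) -> Ck k U f -> Ck k U g.
Proof.
move=> oU; elim: k f g => [|k IH] f g fg /=.
  move=> cf x Ux; have := cf x Ux.
  rewrite /prop_for /continuous_at -fg// => h.
  apply: cvg_trans h; apply: near_eq_cvg.
  have : nbhs x U by apply: open_nbhs_nbhs.
  by apply: filterS => y /fg.
have nfg x : U x -> {near x, f =1 g}.
  move=> Ux; have : nbhs x U by apply: open_nbhs_nbhs.
  by apply: filterS => y /fg.
case=> df Df; split=> [x Ux|v].
  exact: near_eq_differentiable (nfg x Ux) (df x Ux).
apply: IH (Df v) => x Ux; exact/near_eq_derive/nfg.
Qed.

Lemma Ck_sub {W : normedModType R} k (U U' : set V) (f : V -> W) :
  U' `<=` U -> Ck k U f -> Ck k U' f.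
Proof.
move=> UU'; elim: k f => [|k IH] f /=; first by move=> cf x /UU'/cf.
by case=> df Df; split=> [x /UU'/df|v] //; apply: IH.
Qed.

Lemma CkW {W : normedModType R} k (U : set V) (f : V -> W) :
  Ck k.+1 U f -> Ck k U f.
Proof.
elim: k f => [|k IH] f /=; case=> df Df.
  by move=> x /df; apply: differentiable_continuous.
by split=> // v; apply: IH.
Qed.

Lemma Ck_cst {W : normedModType R} k (U : set V) (a : W) : Ck k U (cst a).
Proof.
elim: k a => [|k IH] a /=; first by move=> x _; apply: cst_continuous.
split=> // v; rewrite (_ : (fun x => _) = cst 0)//.
by apply/funext => x; rewrite derive_cst.
Qed.

Lemma CkD {W : normedModType R} k (U : set V) (f g : V -> W) :
  open U -> Ck k U f -> Ck k U g -> Ck k U (fun x => f x + g x).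
Proof.
move=> oU; elim: k f g => [|k IH] f g /=.
  by move=> cf cg x Ux; apply: continuousD; [exact: cf|exact: cg].
move=> [df Df] [dg Dg]; split=> [x Ux|v].
  by apply: differentiableD; [exact: df|exact: dg].
apply: Ck_ext oU _ (IH _ _ (Df v) (Dg v)) => x Ux.
by rewrite -deriveD//; apply: diff_derivable; [exact: df|exact: dg].
Qed.

Lemma Ck_sum {W : normedModType R} k (U : set V) n (f : 'I_n -> V -> W) :
  open U -> (forall j, Ck k U (f j)) -> Ck k U (fun x => \sum_j f j x).
Proof.
move=> oU; elim: n f => [|n IH] f Cf.
  by apply: Ck_ext oU _ (Ck_cst _ _ 0) => x _; rewrite big_ord0.
apply: Ck_ext oU _ (CkD _ _ _ _ oU (IH _ (fun j => Cf _)) (Cf ord_max)) => x _.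
by rewrite big_ord_recr.
Qed.

Lemma CkZl {W : normedModType R} k (U : set V) (a : V -> R^o) (w : W) :
  open U -> Ck k U a -> Ck k U (fun x => a x *: w).
Proof.
move=> oU; elim: k a => [|k IH] a /=.
  by move=> ca x Ux; apply: cvgZr_tmp; exact: ca.
move=> [da Da]; split=> [x Ux|v]; first exact/differentiableZl/da.
apply: Ck_ext oU _ (IH _ (Da v)) => x Ux.
rewrite !deriveE; [|exact/differentiableZl/da|exact: da].
by rewrite diffZl//; apply: da.
Qed.

Lemma CkM k (U : set V) (a b : V -> R^o) :
  open U -> Ck k U a -> Ck k U b -> Ck k U (fun x => a x * b x : R^o).
Proof.
move=> oU; elim: k a b => [|k IH] a b.
  by move=> ca cb x Ux; apply: cvgM; [exact: ca|exact: cb].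
move=> Ca Cb; have [da Da] := Ca; have [db Db] := Cb.
split=> [x Ux|v].
  by apply: differentiableM; [exact: da|exact: db].
apply: Ck_ext oU _ (CkD _ _ _ _ oU (IH _ _ (CkW _ _ _ Ca) (Db v))
  (IH _ _ (CkW _ _ _ Cb) (Da v))) => x Ux.
apply/esym/(@deriveM _ _ a b); apply: diff_derivable; [exact: da|exact: db].
Qed.

Lemma derive_coord n (f : V -> 'rV[R]_n) x v j :
  differentiable f x -> 'D_v (fun y => f y 0 j : R^o) x = 'D_v f x 0 j.
Proof.
by move=> df; rewrite derive_mx ?mxE//; apply: diff_derivable.
Qed.

Lemma Ck_coord k (U : set V) n (f : V -> 'rV[R]_n) j :
  open U -> Ck k U f -> Ck k U (fun x => f x 0 j : R^o).
Proof.
move=> oU; elim: k f => [|k IH] f /=.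
  move=> cf x Ux; apply: (@continuous_comp _ _ _ f (fun M : 'rV[R]_n => M 0 j : R^o)).
    exact: cf.
  exact: coord_continuous.
move=> [df Df]; split=> [x Ux|v].
  apply: (@differentiable_comp _ _ _ _ f (fun M : 'rV[R]_n => M 0 j : R^o)).
    exact: df.
  exact: differentiable_coord.
by apply: Ck_ext oU _ (IH _ (Df v)) => x Ux; rewrite derive_coord//; apply: df.
Qed.

(** A vector-valued map is the sum of its coordinates times constant vectors, so
    [CkZl] and [Ck_sum] reduce everything to scalar functions. *)
Lemma Ck_row k (U : set V) n (f : V -> 'rV[R]_n) :
  open U -> (forall j, Ck k U (fun x => f x 0 j : R^o)) -> Ck k U f.
Proof.
move=> oU Cf.
apply: (Ck_ext _ _ (fun x => \sum_j (f x 0 j) *: delta_mx 0 j)) => //.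
  by move=> x _; rewrite -row_sum_delta.
apply: Ck_sum => // j.
by apply: (@CkZl _ k U (fun x => f x 0 j : R^o)).
Qed.

End Calculus.

Section Composition.
Context {R : realType} {V : normedModType R} {n : nat}.

Lemma derive_sum_delta {W : normedModType R} (g : 'rV[R]_n -> W) y v :
  differentiable g y -> 'D_v g y = \sum_j v 0 j *: 'D_(delta_mx 0 j) g y.
Proof.
move=> dg; rewrite deriveE// {1}(row_sum_delta v) linear_sum.
by apply: eq_bigr => j _; rewrite linearZ deriveE.
Qed.

Lemma derive_compose {W : normedModType R} (f : V -> 'rV[R]_n)
    (g : 'rV[R]_n -> W) x v :
  differentiable f x -> differentiable g (f x) ->
  'D_v (g \o f) x = 'D_('D_v f x) g (f x).
Proof.
move=> df dg; rewrite !deriveE//; last exact: differentiable_comp.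
by rewrite diff_comp.
Qed.

(** By the chain rule a directional derivative of [g \o f] is a sum of products of
    a derivative of a coordinate of [f] and a partial derivative of [g] along
    [f]; the latter are of class C^k by induction. *)
Lemma Ck_comp k (U : set V) (U' : set 'rV[R]_n) (f : V -> 'rV[R]_n)
    (g : 'rV[R]_n -> R^o) :
  open U -> open U' -> (forall x, U x -> U' (f x)) ->
  Ck k U f -> Ck k U' g -> Ck k U (g \o f).
Proof.
move=> oU oU' fU; elim: k g => [|k IH] g.
  by move=> cf cg x Ux; apply: continuous_comp; [exact: cf|exact/cg/fU].
move=> Cf [dg Dg]; have [df Df] := Cf; split=> [x Ux|v].
  by apply: differentiable_comp; [exact: df|exact/dg/fU].
apply: (@Ck_ext _ _ _ _ _ (fun x => \sum_j 'D_v f x 0 j *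
   ((fun y => 'D_(delta_mx 0 j) g y) \o f) x : R^o)) => //.
  move=> x Ux; rewrite derive_compose; [|exact: df|exact/dg/fU].
  by rewrite derive_sum_delta//; exact/dg/fU.
apply: Ck_sum => // j; apply: (@CkM _ _ _ _ (fun x => 'D_v f x 0 j : R^o)) => //.
  exact: Ck_coord (Df v).
exact: IH (CkW _ _ _ Cf) (Dg _).
Qed.

Lemma smooth_comp (U : set V) (U' : set 'rV[R]_n) (f : V -> 'rV[R]_n)
    (g : 'rV[R]_n -> R^o) :
  open U -> open U' -> (forall x, U x -> U' (f x)) ->
  smooth_in U f -> smooth_in U' g -> smooth_in U (g \o f).
Proof. by move=> oU oU' fU sf sg k; exact: Ck_comp (sf k) (sg k). Qed.

Lemma smooth_comp_row (U : set V) (U' : set 'rV[R]_n) (f : V -> 'rV[R]_n)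
    m (g : 'rV[R]_n -> 'rV[R]_m) :
  open U -> open U' -> (forall x, U x -> U' (f x)) ->
  smooth_in U f -> smooth_in U' g -> smooth_in U (g \o f).
Proof.
move=> oU oU' fU sf sg k; apply: Ck_row => // j.
by apply: (Ck_comp k U U' f (fun y => g y 0 j : R^o)) => //; apply: Ck_coord.
Qed.

End Composition.

(** * Maps smooth near a point *)

Section SmoothNear.
Context {R : realType} {V : normedModType R}.

Lemma smooth_cst {W : normedModType R} (U : set V) (a : W) :
  smooth_in U (cst a).
Proof. by move=> k; exact: Ck_cst. Qed.

Lemma smooth_id (U : set V) : smooth_in U id.
Proof.
case=> [|k]; first by move=> x _; exact: cvg_id.
split=> [x _|v]; first exact: ex_diff.
rewrite (_ : (fun x => _) = cst v); first exact: Ck_cst.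
by apply/funext => x; rewrite derive_id.
Qed.

Lemma open_preimage {W : normedModType R} (f : V -> W) (U : set V) (U' : set W) :
  open U -> open U' -> (forall x, U x -> {for x, continuous f}) ->
  open (U `&` f @^-1` U').
Proof.
move=> oU oU' cf; rewrite openE => x [Ux U'fx].
apply: filterI; first exact: open_nbhs_nbhs.
by apply: (cf x Ux); exact: open_nbhs_nbhs.
Qed.

Lemma smooth_near_ext {W : normedModType R} (x : V) (f g : V -> W) :
  {near x, f =1 g} -> smooth_near x f -> smooth_near x g.
Proof.
move=> fg [U [[oU Ux] sf]].
have : nbhs x [set y | f y = g y] by exact: fg.
rewrite nbhsE => -[B [oB Bx] fgB].
exists (U `&` B); split; first by split => //; exact: openI.
move=> k; apply: (@Ck_ext _ _ _ _ _ f); first exact: openI.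
  by move=> y [_ /fgB].
by apply: Ck_sub (sf k) => y [].
Qed.

Lemma smooth_nearD {W : normedModType R} (x : V) (f g : V -> W) :
  smooth_near x f -> smooth_near x g -> smooth_near x (fun y => f y + g y).
Proof.
move=> [U [[oU Ux] sf]] [U' [[oU' Ux'] sg]].
have oI := openI oU oU'.
exists (U `&` U'); split => // k; apply: CkD => //.
  by apply: Ck_sub (sf k) => y [].
by apply: Ck_sub (sg k) => y [].
Qed.

Lemma smooth_nearM (x : V) (f g : V -> R^o) :
  smooth_near x f -> smooth_near x g ->
  smooth_near x (fun y => f y * g y : R^o).
Proof.
move=> [U [[oU Ux] sf]] [U' [[oU' Ux'] sg]].
have oI := openI oU oU'.
exists (U `&` U'); split => // k; apply: CkM => //.
  by apply: Ck_sub (sf k) => y [].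
by apply: Ck_sub (sg k) => y [].
Qed.

Lemma smooth_near_cst {W : normedModType R} (x : V) (a : W) :
  smooth_near x (cst a).
Proof.
exists setT; split; last exact: smooth_cst.
by split => //; exact: openT.
Qed.

Lemma smooth_near_comp {n} (x : V) (f : V -> 'rV[R]_n) (g : 'rV[R]_n -> R^o) :
  smooth_near x f -> smooth_near (f x) g -> smooth_near x (g \o f).
Proof.
move=> [U [[oU Ux] sf]] [U' [[oU' Ux'] sg]].
have oI := open_preimage _ _ _ oU oU' (sf 0%N).
exists (U `&` f @^-1` U'); split => //.
apply: (@smooth_comp _ _ _ _ U') => //; first by move=> y [].
by move=> k; apply: Ck_sub (sf k) => y [].
Qed.

Lemma smooth_near_differentiable {W : normedModType R} (x : V) (f : V -> W) :
  smooth_near x f -> differentiable f x.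
Proof. by move=> [U [[oU Ux] /(_ 1%N) [/(_ x Ux)]]]. Qed.

Lemma smooth_near_derive {W : normedModType R} (x v : V) (f : V -> W) :
  smooth_near x f -> smooth_near x (fun y => 'D_v f y).
Proof.
by move=> [U [oU sf]]; exists U; split => // k; have [_] := sf k.+1; exact.
Qed.

End SmoothNear.

(** * Smooth functions on a manifold *)

Section SmoothFunctions.
Context {R : realType} {n : nat} {M : manifold R n}.
Implicit Types (c d : chart R n M) (p q : M) (f g : M -> R).

Lemma near_coordV c p (A : set M) :
  dom c p -> nbhs p A -> \forall x \near coord c p, A (coordV c x).
Proof.
move=> cp nA; have ip : (coord c @` dom c) (coord c p) by exists p.
by apply: (coordV_cont ip); rewrite coordK.
Qed.

Lemma near_coord c p (B : set 'rV[R]_n) :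
  dom c p -> nbhs (coord c p) B -> \forall q \near p, B (coord c q).
Proof. by move=> cp; exact: (coord_cont cp). Qed.

Lemma near_dom c p : dom c p -> \forall q \near p, dom c q.
Proof. by move=> cp; apply: open_nbhs_nbhs; split=> //; exact: dom_open. Qed.

Lemma near_image c p : dom c p ->
  \forall x \near coord c p, (coord c @` dom c) x.
Proof.
move=> cp; apply: open_nbhs_nbhs; split; first exact: image_open.
by exists p.
Qed.

Lemma coordVK c x : (coord c @` dom c) x -> coord c (coordV c x) = x.
Proof. by case=> p cp <-; rewrite coordK. Qed.

Lemma open_coord_image c (A : set M) :
  open A -> open (coord c @` (dom c `&` A)).
Proof.
move=> oA; rewrite openE => _ [p [cp Ap] <-].
have nA : nbhs p A by apply: open_nbhs_nbhs.
apply: filterS2 (near_image c p cp) (near_coordV c p A cp nA) => _ [q cq <-].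
by rewrite coordK// => Aq; exists q.
Qed.

Lemma smooth_transition c d p : atlas c -> atlas d -> dom c p -> dom d p ->
  smooth_near (coord c p) (coord d \o coordV c).
Proof.
move=> ac ad cp dp; exists (coord c @` (dom c `&` dom d)).
split; last exact: atlas_compat.
by split; [apply: open_coord_image; exact: dom_open|exists p].
Qed.

(** The transition maps are smooth, so one chart decides for all the others. *)
Lemma smooth_at_chart c p f : atlas c -> dom c p ->
  smooth_near (coord c p) (f \o coordV c : 'rV[R]_n -> R^o) -> smooth_at p f.
Proof.
move=> ac cp sf d ad dp.
apply: (@smooth_near_ext _ _ _ _
  ((f \o coordV c : 'rV[R]_n -> R^o) \o (coord c \o coordV d))).
  apply: filterS (near_coordV d p _ dp (near_dom c p cp)) => x cx.
  by rewrite /= coordK.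
apply: smooth_near_comp; first exact: smooth_transition.
by rewrite /= coordK.
Qed.

Lemma smooth_at_ext p f g : {near p, f =1 g} -> smooth_at p f -> smooth_at p g.
Proof.
move=> fg sf c ac cp; apply: smooth_near_ext (sf c ac cp).
exact: near_coordV c p _ cp fg.
Qed.

Lemma smooth_at_near p f : smooth_at p f -> \forall q \near p, smooth_at q f.
Proof.
move=> sf; have [c ac cp] := atlas_cover p.
have [U [[oU Up] sU]] := sf c ac cp.
have nU : nbhs (coord c p) U by apply: open_nbhs_nbhs.
apply: filterS2 (near_coord c p U cp nU) (near_dom c p cp) => q Uq cq.
by apply: (smooth_at_chart c) => //; exists U.
Qed.

Lemma smooth_at_cst p (a : R) : smooth_at p (cst a).
Proof.
by move=> c _ _; exact: (@smooth_near_cst _ _ R^o (coord c p) a).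
Qed.

Lemma smooth_atD p f g :
  smooth_at p f -> smooth_at p g -> smooth_at p (fun q => f q + g q).
Proof.
by move=> sf sg c ac cp; apply: smooth_nearD; [exact: sf|exact: sg].
Qed.

Lemma smooth_atM p f g :
  smooth_at p f -> smooth_at p g -> smooth_at p (fun q => f q * g q).
Proof.
by move=> sf sg c ac cp; apply: smooth_nearM; [exact: sf|exact: sg].
Qed.

Lemma smooth_at_sum p k (f : 'I_k -> M -> R) :
  (forall j, smooth_at p (f j)) -> smooth_at p (fun q => \sum_j f j q).
Proof.
elim: k f => [|k IH] f sf.
  rewrite (_ : (fun q => _) = cst 0); first exact: smooth_at_cst.
  by apply/funext => q; rewrite big_ord0.
rewrite (_ : (fun q => _) = fun q =>
  \sum_(j < k) f (widen_ord (leqnSn k) j) q + f ord_max q).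
  by apply: smooth_atD => //; apply: IH => j; exact: sf.
by apply/funext => q; rewrite big_ord_recr.
Qed.

Lemma smooth_at_coord c p j : atlas c -> dom c p ->
  smooth_at p (fun q => coord c q 0 j).
Proof.
move=> ac cp; apply: (smooth_at_chart c) => //.
apply: (@smooth_near_ext _ _ _ _ (fun x : 'rV[R]_n => x 0 j : R^o)).
  by apply: filterS (near_image c p cp) => x ix /=; rewrite coordVK.
exists setT; split; first by split => //; exact: openT.
by move=> k; exact: Ck_coord openT (smooth_id _ k).
Qed.

Lemma smooth_at_differentiable c p f : atlas c -> dom c p -> smooth_at p f ->
  differentiable (f \o coordV c : 'rV[R]_n -> R^o) (coord c p).
Proof. by move=> ac cp sf; apply: smooth_near_differentiable; exact: sf. Qed.

End SmoothFunctions.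

(** * Tangent vectors in a chart *)

Section TangentVectors.
Context {R : realType} {n : nat} {M : manifold R n}.
Implicit Types (c d : chart R n M) (p q : M) (f g : M -> R).
Local Notation operator := ((M -> R) -> R^o).

(** The combination, with constant coefficients [w], of the coordinate fields of
    [c]; such fields extend any given tangent vector. *)
Definition chart_field c (w : 'rV[R]_n) (p : M) : operator :=
  at_point p (fun f => 'D_w (f \o coordV c : 'rV[R]_n -> R^o) (coord c p)).

Lemma at_pointE p (D : operator) f : smooth_at p f -> at_point p D f = D f.
Proof. by move=> sf; rewrite /at_point asboolT. Qed.

Lemma at_point0 p (D : operator) f : ~ smooth_at p f -> at_point p D f = 0.
Proof. by move=> sf; rewrite /at_point asboolF. Qed.

Lemma at_point_eq p (D E : operator) :
  (forall f, smooth_at p f -> D f = E f) -> at_point p D = at_point p E.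
Proof.
move=> DE; apply/funext => f; rewrite /at_point.
by case: asboolP => // /DE.
Qed.

Lemma smooth_curve_line c p w : atlas c -> dom c p ->
  smooth_curve (fun t : R => coordV c (t *: w + coord c p)).
Proof.
move=> ac cp d ad; rewrite scale0r add0r coordK// => dp.
pose l := fun t : R^o => t *: w + coord c p.
pose A := coord c @` (dom c `&` dom d).
have oA : open A by apply: open_coord_image; exact: dom_open.
have sl : smooth_in setT l.
  move=> k; apply: CkD => //; [exact: openT| |exact: Ck_cst].
  apply: (@CkZl _ _ _ _ _ (id : R^o -> R^o)); first exact: openT.
  exact: smooth_id.
have oW : open (l @^-1` A).
  by rewrite -(setTI (_ @^-1` _)); apply: open_preimage (sl 0%N) => //; exact: openT.
exists (l @^-1` A); split.
- split=> //; rewrite /A /preimage/= /l scale0r add0r.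
  by exists p.
- by move=> _ [t [q [cq dq] qt] <-]; rewrite -/(l t) -qt coordK.
- apply: (@smooth_comp_row _ _ _ _ A l _ (coord d \o coordV c)) => //.
    by move=> k; apply: Ck_sub (sl k).
  exact: atlas_compat.
Qed.

(** This is what makes the set of velocities a vector space.  The derivative of
    a curve read in the chart provides the direction, by the chain rule;
    conversely a straight line in the chart has any prescribed direction. *)
Lemma tangent_chartP c p (v : operator) : atlas c -> dom c p ->
  tangent p v <-> exists w, v = chart_field c w p.
Proof.
move=> ac cp; split=> [[gamma [g0 sg ->]]|[w ->]].
  exists ('D_1 (coord c \o gamma : R^o -> 'rV[R]_n) 0).
  rewrite /velocity g0; apply: at_point_eq => f sf.
  have cg0 : dom c (gamma 0) by rewrite g0.
  have [W [[oW W0] Wc sW]] := sg c ac cg0.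
  have dg : differentiable (coord c \o gamma : R^o -> 'rV[R]_n) 0.
    by have [/(_ 0 W0)] := sW 1%N.
  have df : differentiable (f \o coordV c : 'rV[R]_n -> R^o)
      ((coord c \o gamma) 0).
    by rewrite /= g0; exact: smooth_at_differentiable.
  rewrite derive1E -[in coord c p]g0 -(derive_compose _ _ _ _ dg df).
  apply: near_eq_derive.
  have : nbhs (0 : R^o) W by apply: open_nbhs_nbhs.
  by apply: filterS => t Wt /=; rewrite coordK//; apply: Wc; exists t.
exists (fun t => coordV c (t *: w + coord c p)); split.
- by rewrite scale0r add0r coordK.
- exact: smooth_curve_line.
- rewrite /velocity scale0r add0r coordK//.
  apply: at_point_eq => f sf; rewrite /derive1 /derive.
  set d := (fun _ : R => _); set d' := (fun _ : R => _).
  suff -> : d' = d by [].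
  by apply/funext => h; rewrite /d /d' /= addr0 scale0r add0r.
Qed.

Section AtPoint.
Context {p : M}.
Implicit Types (u v : operator).

Lemma chart_fieldE c w f : smooth_at p f ->
  chart_field c w p f = 'D_w (f \o coordV c : 'rV[R]_n -> R^o) (coord c p).
Proof. exact: at_pointE. Qed.

Lemma chart_field_lin c a w1 w2 : atlas c -> dom c p ->
  chart_field c (a *: w1 + w2) p =
  a *: chart_field c w1 p + chart_field c w2 p.
Proof.
move=> ac cp; apply/funext => f; rewrite !fctE.
have [sf|sf] := pselect (smooth_at p f); last first.
  by rewrite /chart_field !at_point0// scaler0 addr0.
have df := smooth_at_differentiable _ _ _ ac cp sf.
by rewrite !chart_fieldE// !deriveE// linearP.
Qed.

Lemma chart_field0 c : atlas c -> dom c p -> chart_field c 0 p = 0.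
Proof.
move=> ac cp; have := chart_field_lin c (- 1) 0 0 ac cp.
by rewrite scaler0 addr0 scaleN1r addNr.
Qed.

Lemma tangent_lin a u v :
  tangent p u -> tangent p v -> tangent p (a *: u + v).
Proof.
have [c ac cp] := atlas_cover p.
move=> /(tangent_chartP c p _ ac cp)[w1 ->] /(tangent_chartP c p _ ac cp)[w2 ->].
apply/(tangent_chartP c p _ ac cp); exists (a *: w1 + w2).
by rewrite chart_field_lin.
Qed.

Lemma tangent0 : tangent p 0.
Proof.
have [c ac cp] := atlas_cover p.
by apply/(tangent_chartP c p _ ac cp); exists 0; rewrite chart_field0.
Qed.

Lemma tangentD u v : tangent p u -> tangent p v -> tangent p (u + v).
Proof. by move=> tu tv; rewrite -[u]scale1r; exact: tangent_lin. Qed.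

Lemma tangentZ a u : tangent p u -> tangent p (a *: u).
Proof. by move=> tu; rewrite -[_ *: _]addr0; apply: tangent_lin tangent0. Qed.

Lemma tangentN u : tangent p u -> tangent p (- u).
Proof. by move=> tu; rewrite -scaleN1r; exact: tangentZ. Qed.

Lemma tangentB u v : tangent p u -> tangent p v -> tangent p (u - v).
Proof. by move=> tu tv; apply: tangentD => //; exact: tangentN. Qed.

Lemma tangent_at_point v : tangent p v -> at_point p v = v.
Proof.
move=> [gamma [g0 _ ->]]; apply/funext => f; rewrite /velocity g0.
have [sf|sf] := pselect (smooth_at p f); first by rewrite at_pointE.
by rewrite !at_point0.
Qed.

Lemma tangent_nsmooth v f : tangent p v -> ~ smooth_at p f -> v f = 0.
Proof. by move=> /tangent_at_point <- sf; rewrite at_point0. Qed.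

(** Functions that agree near [p] are smooth at [p] together, and tangent vectors
    take the value 0 on the functions that are not. *)
Lemma tangent_ext v f g : tangent p v -> {near p, f =1 g} -> v f = v g.
Proof.
move=> tv fg; have [sf|sf] := pselect (smooth_at p f); last first.
  rewrite !(tangent_nsmooth v)// => sg; apply: sf; apply: smooth_at_ext sg.
  by apply: filterS fg.
have sg := smooth_at_ext _ _ _ fg sf.
have [c ac cp] := atlas_cover p.
move: tv => /(tangent_chartP c p _ ac cp)[w ->].
rewrite !chart_fieldE//; apply: near_eq_derive.
exact: near_coordV c p _ cp fg.
Qed.

Lemma tangent_cst v (a : R) : tangent p v -> v (cst a) = 0.
Proof.
have [c ac cp] := atlas_cover p.
move=> /(tangent_chartP c p _ ac cp)[w ->].
rewrite chart_fieldE; last exact: smooth_at_cst.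
by rewrite -[_ \o _]/(cst a) derive_cst.
Qed.

Lemma tangent_derivD v f g : tangent p v -> smooth_at p f -> smooth_at p g ->
  v (fun q => f q + g q) = v f + v g.
Proof.
have [c ac cp] := atlas_cover p.
move=> /(tangent_chartP c p _ ac cp)[w ->] sf sg.
rewrite !chart_fieldE//; last exact: smooth_atD.
rewrite -(@deriveD _ _ R^o)//; apply: diff_derivable.
  exact: smooth_at_differentiable.
exact: smooth_at_differentiable.
Qed.

Lemma tangent_derivM v f g : tangent p v -> smooth_at p f -> smooth_at p g ->
  v (fun q => f q * g q) = v f * g p + f p * v g.
Proof.
have [c ac cp] := atlas_cover p.
move=> /(tangent_chartP c p _ ac cp)[w ->] sf sg.
rewrite !chart_fieldE//; last exact: smooth_atM.
have := @deriveM _ _ (f \o coordV c) (g \o coordV c) (coord c p) w.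
rewrite /= coordK// => dfg.
rewrite addrC [X in _ + X]mulrC; apply: dfg; apply: diff_derivable.
  exact: smooth_at_differentiable.
exact: smooth_at_differentiable.
Qed.

Lemma tangent_deriv_sum v k (f : 'I_k -> M -> R) : tangent p v ->
  (forall j, smooth_at p (f j)) ->
  v (fun q => \sum_j f j q) = \sum_j v (f j).
Proof.
move=> tv; elim: k f => [|k IH] f sf.
  rewrite big_ord0 (_ : (fun q => _) = cst 0); first exact: tangent_cst.
  by apply/funext => q; rewrite big_ord0.
rewrite (_ : (fun q => _) = fun q =>
  \sum_(j < k) f (widen_ord (leqnSn k) j) q + f ord_max q); last first.
  by apply/funext => q; rewrite big_ord_recr.
rewrite tangent_derivD//; last exact: smooth_at_sum.
by rewrite IH// big_ord_recr.
Qed.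

Lemma chart_field_coord c w j : atlas c -> dom c p ->
  chart_field c w p (fun q => coord c q 0 j) = w 0 j.
Proof.
move=> ac cp; rewrite chart_fieldE; last exact: smooth_at_coord.
rewrite (@near_eq_derive _ _ _ _ (fun x : 'rV[R]_n => x 0 j : R^o)).
  by rewrite (@derive_coord _ _ _ id) ?derive_id//; exact: ex_diff.
by apply: filterS (near_image c p cp) => x ix /=; rewrite coordVK.
Qed.

Lemma tangent_coordE c v : atlas c -> dom c p -> tangent p v ->
  v = chart_field c (\row_j v (fun q => coord c q 0 j)) p.
Proof.
move=> ac cp /(tangent_chartP c p _ ac cp)[w ->]; congr chart_field.
by apply/rowP => j; rewrite mxE chart_field_coord.
Qed.

End AtPoint.

Lemma tangent_chart_field c w p :
  atlas c -> dom c p -> tangent p (chart_field c w p).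
Proof. by move=> ac cp; apply/(tangent_chartP c p _ ac cp); exists w. Qed.

Lemma vector_field_chart c w : atlas c -> vector_field (dom c) (chart_field c w).
Proof.
move=> ac p cp; split; first exact: tangent_chart_field.
move=> f sf; apply: (smooth_at_chart c) => //.
apply: (@smooth_near_ext _ _ _ _
  (fun x => 'D_w (f \o coordV c : 'rV[R]_n -> R^o) x)).
  have ns := near_coordV c p _ cp (smooth_at_near p f sf).
  apply: filterS2 ns (near_image c p cp) => x sx ix /=.
  by rewrite chart_fieldE// coordVK.
by apply: smooth_near_derive; exact: sf.
Qed.

(** The coordinates have locally constant derivatives along both fields, so the
    bracket annihilates them; a tangent vector is determined by its values on
    the coordinates. *)
Lemma chart_field_bracket c w1 w2 p : atlas c -> dom c p ->
  tangent p (lie_bracket (chart_field c w1) (chart_field c w2) p) ->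
  lie_bracket (chart_field c w1) (chart_field c w2) p = 0.
Proof.
move=> ac cp tb; rewrite (tangent_coordE c _ ac cp tb).
rewrite (_ : \row_j _ = 0) ?chart_field0//; apply/rowP => j; rewrite !mxE.
rewrite /lie_bracket at_pointE; last exact: smooth_at_coord.
have dcst w w' : chart_field c w p
    (fun q => chart_field c w' q (fun q => coord c q 0 j)) = 0.
  rewrite (@tangent_ext p _ _ (cst (w' 0 j))).
  - by rewrite (tangent_cst (p := p))//; exact: tangent_chart_field.
  - exact: tangent_chart_field.
  - by apply: filterS (near_dom c p cp) => q cq; rewrite chart_field_coord.
by rewrite !dcst subr0.
Qed.

Lemma vector_field_sub (U U' : set M) (X : M -> operator) :
  U' `<=` U -> vector_field U X -> vector_field U' X.
Proof. by move=> UU' vX p /UU'/vX. Qed.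

Lemma vector_field0 (U : set M) : vector_field U (fun _ => 0).
Proof.
move=> p _; split; first exact: tangent0.
by move=> f _; exact: smooth_at_cst.
Qed.

End TangentVectors.

(** * Metric and torsion-free connections *)

Section LeviCivita.
Context {R : realType} {n : nat} {M : manifold R n}.
Local Notation operator := ((M -> R) -> R^o).
Context {g : M -> operator -> operator -> R}.
Hypothesis gC : forall p u v, tangent p u -> tangent p v -> g p u v = g p v u.
Hypothesis gL : forall p a u v w, tangent p u -> tangent p v -> tangent p w ->
  g p (a *: u + v) w = a * g p u w + g p v w.

Lemma inner0l p w : tangent p w -> g p 0 w = 0.
Proof.
move=> tw; have := gL p (-1) 0 0 w tangent0 tangent0 tw.
by rewrite scaler0 addr0 mulN1r addNr.
Qed.

Lemma inner0r p w : tangent p w -> g p w 0 = 0.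
Proof. by move=> tw; rewrite gC ?inner0l//; exact: tangent0. Qed.

Lemma innerZl p a u w : tangent p u -> tangent p w -> g p (a *: u) w = a * g p u w.
Proof.
move=> tu tw; rewrite -[a *: u]addr0 gL ?inner0l ?addr0//; exact: tangent0.
Qed.

Lemma innerNl p u w : tangent p u -> tangent p w -> g p (- u) w = - g p u w.
Proof. by move=> tu tw; rewrite -scaleN1r innerZl// mulN1r. Qed.

Lemma innerDl p u v w : tangent p u -> tangent p v -> tangent p w ->
  g p (u + v) w = g p u w + g p v w.
Proof. by move=> tu tv tw; rewrite -[u]scale1r gL// mul1r scale1r. Qed.

Lemma innerBl p u v w : tangent p u -> tangent p v -> tangent p w ->
  g p (u - v) w = g p u w - g p v w.
Proof.
by move=> tu tv tw; rewrite innerDl// ?innerNl//; exact: tangentN.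
Qed.

Context {nabla : (M -> operator) -> (M -> operator) -> M -> operator}.

Lemma conn_zero U X p : connection nabla -> open U -> vector_field U X -> U p ->
  nabla X (fun _ => 0) p = 0.
Proof.
move=> cn oU vX Up.
have := conn_addr cn oU vX (vector_field0 U) (vector_field0 U) Up.
rewrite (_ : (fun _ => 0 + 0) = (fun _ : M => 0 : operator)); last first.
  by apply/funext => q; rewrite addr0.
by move=> h; apply: (addrI (nabla X (fun _ => 0) p)); rewrite addr0 -h.
Qed.

Hypothesis LC : levi_civita g nabla.

Lemma tangent_nabla U X Y p : open U -> vector_field U X -> vector_field U Y ->
  U p -> tangent p (nabla X Y p).
Proof.
by move=> oU vX vY Up; have [] := conn_field (lc_connection LC) oU vX vY Up.
Qed.

Lemma tangent_lie_bracket (U : set M) X Y p : open U -> vector_field U X ->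
  vector_field U Y -> U p -> tangent p (lie_bracket X Y p).
Proof.
move=> oU vX vY Up; rewrite -(lc_torsion_free LC oU vX vY Up).
by apply: tangentB; exact: tangent_nabla oU _ _ Up.
Qed.

(** When [g Y Z] and [g X Z] are differentiated by metric compatibility, the terms
    [g (nabla X Y) Z] and [g (nabla Y X) Z] differ by the bracket, the torsion
    being zero.  The left-hand side is the exterior derivative of the form dual
    to [Z], evaluated at [X] and [Y]. *)
Lemma exterior_derivative_dual (U : set M) X Y Z p : open U -> vector_field U X ->
  vector_field U Y -> vector_field U Z -> U p ->
  X p (fun q => g q (Y q) (Z q)) - Y p (fun q => g q (X q) (Z q)) -
    g p (lie_bracket X Y p) (Z p) =
  g p (nabla X Z p) (Y p) - g p (nabla Y Z p) (X p).
Proof.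
move=> oU vX vY vZ Up.
have [[tX _] [tY _] [tZ _]] := And3 (vX p Up) (vY p Up) (vZ p Up).
have tn A B : vector_field U A -> vector_field U B -> tangent p (nabla A B p).
  by move=> vA vB; exact: tangent_nabla oU vA vB Up.
rewrite !(lc_metric LC oU _ _ _ Up)// -(lc_torsion_free LC oU vX vY Up).
rewrite innerBl ?(gC p (Y p)) ?(gC p (X p))//; try exact: tn.
rewrite [g p (nabla X Y p) _ + _]addrC [g p (nabla Y X p) _ + _]addrC.
by rewrite opprD opprB addrACA addrA [_ + _ - _]addrC; ring.
Qed.

End LeviCivita.

(** * The exterior derivative of a pulled back form *)

Section ExteriorDerivative.
Context {R : realType}.

Lemma linear_row_sum {n} (F : 'rV[R]_n -> R) (w : 'rV[R]_n) :
  (forall a u v, F (a *: u + v) = a * F u + F v) ->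
  F w = \sum_j w 0 j * F (delta_mx 0 j).
Proof.
move=> FL; have F0 : F 0 = 0.
  by have := FL (-1) 0 0; rewrite scaler0 addr0 mulN1r addNr.
rewrite {1}[w]row_sum_delta.
by elim/big_rec2: _ => // j y x _ <-; rewrite FL.
Qed.

Section Naturality.
Context {k n : nat} {M : manifold R k} {N : manifold R n} {i : M -> N}.
Local Notation operator M := ((M -> R) -> R^o).
Hypothesis smi : smooth_map i.

Lemma smooth_at_pullback p f : smooth_at (i p) f -> smooth_at p (f \o i).
Proof.
move=> sf; have [ci si] := smi.
have [c ac cp] := atlas_cover p; have [d ad dp] := atlas_cover (i p).
apply: (smooth_at_chart c) => //.
apply: (@smooth_near_ext _ _ _ _
  ((f \o coordV d : 'rV[R]_n -> R^o) \o (coord d \o i \o coordV c))).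
  have nd : \forall q \near p, dom d (i q) by apply: ci; exact: near_dom.
  apply: filterS (near_coordV c p _ cp nd) => x dx.
  by rewrite /= coordK.
by apply: smooth_near_comp; [exact: si|rewrite /= coordK//; exact: sf].
Qed.

Lemma differentialE p (v : operator M) f :
  smooth_at (i p) f -> differential i p v f = v (f \o i).
Proof. exact: at_pointE. Qed.

Lemma differential_lin p a (u v : operator M) :
  differential i p (a *: u + v) = a *: differential i p u + differential i p v.
Proof.
apply/funext => f; rewrite !fctE.
have [sf|sf] := pselect (smooth_at (i p) f); first by rewrite !differentialE.
by rewrite /differential !at_point0// scaler0 addr0.
Qed.

Lemma differential0 p : differential i p 0 = 0.
Proof.
by have := differential_lin p (-1) 0 0; rewrite scaler0 addr0 scaleN1r addNr.
Qed.

(** In charts the differential sends the direction [w] to the derivative along [w]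
    of the coordinate expression of [i]. *)
Lemma tangent_differential p (v : operator M) :
  tangent p v -> tangent (i p) (differential i p v).
Proof.
have [ci si] := smi.
have [c ac cp] := atlas_cover p; have [d ad dp] := atlas_cover (i p).
move=> /(tangent_chartP c p _ ac cp)[w ->].
apply/(tangent_chartP d (i p) _ ad dp).
exists ('D_w (coord d \o i \o coordV c) (coord c p)).
apply: at_point_eq => f sf.
rewrite chart_fieldE; last exact: smooth_at_pullback.
have h : differentiable (coord d \o i \o coordV c) (coord c p).
  by apply: smooth_near_differentiable; exact: si.
have df : differentiable (f \o coordV d : 'rV[R]_n -> R^o)
    ((coord d \o i \o coordV c) (coord c p)).
  by rewrite /= coordK//; exact: smooth_at_differentiable.
have -> : coord d (i p) = (coord d \o i \o coordV c) (coord c p).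
  by rewrite /= coordK.
rewrite -(derive_compose _ _ _ _ h df).
apply: near_eq_derive.
have nd : \forall q \near p, dom d (i q) by apply: ci; exact: near_dom.
apply: filterS (near_coordV c p _ cp nd) => x dx.
by rewrite /= coordK.
Qed.

Context {theta : N -> operator N -> R}.
Hypothesis thetaP : one_form theta.

Lemma one_form_chart_sum d q (w : 'rV[R]_n) : atlas d -> dom d q ->
  theta q (chart_field d w q) =
  \sum_j w 0 j * theta q (chart_field d (delta_mx 0 j) q).
Proof.
move=> ad dq.
apply: (linear_row_sum (fun w => theta q (chart_field d w q))) => a u v.
by rewrite chart_field_lin// (proj1 thetaP)//; exact: tangent_chart_field.
Qed.

(** In the chart [d], the pulled back form evaluated at [Y] is the sum over [j]
    of [Y y_j] times the pulled back coefficient, where [y_j] is the [j]-th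
    coordinate of [i]: the second order terms [X (Y y_j) - Y (X y_j)] make up
    the value at the bracket, and the first order terms the right-hand side. *)
Lemma exterior_derivative_pullback U X Y p d w1 w2 : open U ->
  vector_field U X -> vector_field U Y -> U p ->
  tangent p (lie_bracket X Y p) -> atlas d -> dom d (i p) ->
  differential i p (X p) = chart_field d w1 (i p) ->
  differential i p (Y p) = chart_field d w2 (i p) ->
  X p (fun q => theta (i q) (differential i q (Y q))) -
  Y p (fun q => theta (i q) (differential i q (X q))) -
  theta (i p) (differential i p (lie_bracket X Y p)) =
  chart_field d w1 (i p) (fun q => theta q (chart_field d w2 q)) -
  chart_field d w2 (i p) (fun q => theta q (chart_field d w1 q)).
Proof.
move=> oU vX vY Up tb ad dp Xw Yw.
pose b j q := theta q (chart_field d (delta_mx 0 j) q).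
pose y j q := coord d (i q) 0 j.
have sb j : smooth_at (i p) (b j).
  by apply: (proj2 thetaP _ _ (dom_open d) (vector_field_chart d _ ad)).
have sbi j : smooth_at p (b j \o i) by exact: smooth_at_pullback.
have sy j q : dom d (i q) -> smooth_at q (y j).
  by move=> dq; apply: (smooth_at_pullback _ (fun x => coord d x 0 j));
     exact: smooth_at_coord.
have coefE q v : dom d (i q) -> tangent q v ->
    theta (i q) (differential i q v) = \sum_j v (y j) * b j (i q).
  move=> dq tv; rewrite (tangent_coordE d (differential i q v) ad dq);
    last exact: tangent_differential.
  rewrite one_form_chart_sum//; apply: eq_bigr => j _; rewrite mxE.
  by rewrite differentialE//; exact: smooth_at_coord.
have nU : \forall q \near p, U q by apply: open_nbhs_nbhs.
have nd : \forall q \near p, dom d (i q).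
  by apply: (proj1 smi); exact: near_dom.
have coordw Z w j : differential i p Z = chart_field d w (i p) -> Z (y j) = w 0 j.
  move=> Zw; rewrite -(chart_field_coord d w j ad dp) -Zw differentialE//.
  exact: smooth_at_coord.
(* The Leibniz rule: the derivative of [b j \o i] along [Z] is that of [b j]
   along the image of [Z], so these terms add up to the derivative of
   [theta (chart_field d w')] along [chart_field d w]. *)
have derivE Z Z' w w' : vector_field U Z -> vector_field U Z' ->
    differential i p (Z p) = chart_field d w (i p) ->
    differential i p (Z' p) = chart_field d w' (i p) ->
    Z p (fun q => theta (i q) (differential i q (Z' q))) =
    \sum_j Z p (fun q => Z' q (y j)) * b j (i p) +
    chart_field d w (i p) (fun q => theta q (chart_field d w' q)).
  move=> vZ vZ' Zw Zw'; have [tZ _] := vZ p Up.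
  have tc := tangent_chart_field d w (i p) ad dp.
  have sZ j : smooth_at p (fun q => Z' q (y j)) by apply: (vZ' p Up).2; exact: sy.
  rewrite (@tangent_ext _ _ _ _ _ _
    (fun q => \sum_j Z' q (y j) * (b j \o i) q) tZ); last first.
    apply: filterS2 nU nd => q Uq dq; rewrite coefE//.
    by have [] := vZ' q Uq.
  rewrite (tangent_deriv_sum _ _ _ tZ); last by move=> j; exact: smooth_atM.
  rewrite (@tangent_ext _ _ _ _ _ (fun q => theta q (chart_field d w' q))
    (fun q => \sum_j cst (w' 0 j) q * b j q) tc); last first.
    apply: filterS (near_dom d (i p) dp) => q dq.
    by rewrite one_form_chart_sum.
  rewrite (tangent_deriv_sum _ _ _ tc); last first.
    by move=> j; apply: smooth_atM => //; exact: smooth_at_cst.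
  rewrite -big_split; apply: eq_bigr => j _ /=.
  rewrite (tangent_derivM _ (fun q => Z' q (y j)) (b j \o i) tZ)//.
  rewrite (tangent_derivM _ (cst (w' 0 j)) (b j) tc)//; last first.
    exact: smooth_at_cst.
  rewrite (tangent_cst _ _ tc) mul0r add0r (coordw _ _ _ Zw') -Zw differentialE//.
rewrite (derivE X Y w1 w2)// (derivE Y X w2 w1)// coefE//.
have -> : \sum_j lie_bracket X Y p (y j) * b j (i p) =
    \sum_j X p (fun q => Y q (y j)) * b j (i p) -
    \sum_j Y p (fun q => X q (y j)) * b j (i p).
  rewrite -sumrB; apply: eq_bigr => j _; rewrite -mulrBl.
  by rewrite /lie_bracket at_pointE//; exact: sy.
have cancel (a1 a2 b1 b2 : R) : a1 + b1 - (a2 + b2) - (a1 - a2) = b1 - b2.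
  by ring.
exact: cancel.
Qed.

End Naturality.
End ExteriorDerivative.

(** * Sasakian identities *)

Section SasakianIdentities.
Context {R : realType} {m : nat} {N : sasakian R m}.
Implicit Types (p : N) (u v : (N -> R) -> R^o).
Local Notation g := (@metric _ _ N).
Local Notation phi := (@phi _ _ N).
Local Notation xi := (@xi _ _ N).
Local Notation eta := (@Defs.eta _ _ N).

Let gC p u v : tangent p u -> tangent p v -> g p u v = g p v u.
Proof. by have [+ _ _ _] := metricP N; apply. Qed.

Let gL p a u v w : tangent p u -> tangent p v -> tangent p w ->
  g p (a *: u + v) w = a * g p u w + g p v w.
Proof. by have [_ + _ _] := metricP N; apply. Qed.

Lemma metric_eq0 p u : tangent p u -> g p u u = 0 -> u = 0.
Proof.
move=> tu gu; apply: contrapT => u0.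
have [_ _ + _] := metricP N => /(_ p u tu u0).
by rewrite gu ltxx.
Qed.

Lemma tangent_phi p u : tangent p u -> tangent p (phi p u).
Proof. by have [+ _ _] := phi_tensor N; apply. Qed.

Lemma phi_lin p a u v : tangent p u -> tangent p v ->
  phi p (a *: u + v) = a *: phi p u + phi p v.
Proof. by have [_ + _] := phi_tensor N; apply. Qed.

Lemma phi0 p : phi p 0 = 0.
Proof.
have := phi_lin p (-1) 0 0 tangent0 tangent0.
by rewrite scaler0 addr0 scaleN1r addNr.
Qed.

Lemma phiN p u : tangent p u -> phi p (- u) = - phi p u.
Proof.
move=> tu; have := phi_lin p (-1) u 0 tu tangent0.
by rewrite !addr0 phi0 addr0 !scaleN1r.
Qed.

Lemma tangent_xi p : tangent p (xi p).
Proof. by have [] := @xi_field _ _ N p I. Qed.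

Lemma eta_lin p a u v : tangent p u -> tangent p v ->
  eta p (a *: u + v) = a * eta p u + eta p v.
Proof. by have [+ _] := eta_form N; apply. Qed.

Lemma eta0 p : eta p 0 = 0.
Proof.
have := eta_lin p (-1) 0 0 tangent0 tangent0.
by rewrite scaler0 addr0 mulN1r addNr.
Qed.

Lemma metric_xi p u : tangent p u -> g p u (xi p) = eta p u.
Proof.
move=> tu; have tx := tangent_xi p.
have := metric_phi tu tx.
rewrite phi_xi eta_xi mulr1 (inner0r gC gL); last exact: tangent_phi.
by move=> /esym/eqP; rewrite subr_eq0 => /eqP.
Qed.

(** Computing [phi (phi (phi u))] from the outer or from the inner pair gives
    [- phi u + eta (phi u) *: xi] or [- phi u]. *)
Lemma eta_phi p u : tangent p u -> eta p (phi p u) = 0.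
Proof.
move=> tu; have tx := tangent_xi p; have tpu := tangent_phi p u tu.
have := phi_phi tpu; rewrite {1}(phi_phi tu).
rewrite addrC phi_lin//; last exact: tangentN.
rewrite phi_xi scaler0 add0r phiN// => e.
have /(congr1 (eta p)) : eta p (phi p u) *: xi p = 0.
  by apply: (addrI (- phi p u)); rewrite addr0 -e.
rewrite -[_ *: _]addr0 eta_lin//; last exact: tangent0.
by rewrite eta_xi eta0 addr0 mulr1.
Qed.

Lemma phi_skew p u v : tangent p u -> tangent p v ->
  g p (phi p u) v = - g p u (phi p v).
Proof.
move=> tu tv; have tx := tangent_xi p.
have tpu := tangent_phi p u tu; have tpv := tangent_phi p v tv.
have := metric_phi tu tpv; rewrite eta_phi// mulr0 subr0 => <-.
have t2 : tangent p (eta p v *: xi p - v).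
  by apply: tangent_lin => //; exact: tangentN.
rewrite phi_phi// [- v + _]addrC (gC _ _ _ tpu t2) gL//; last exact: tangentN.
rewrite (gC _ _ _ tx tpu) metric_xi// eta_phi// mulr0 add0r.
by rewrite (innerNl gL)// opprK gC.
Qed.

(** Taking [Y = xi] in the identity for the covariant derivative of [phi] and
    applying [phi] determines [nabla_X xi] up to a multiple of [xi]; that
    multiple is 0 since [xi] has constant length. *)
Lemma nabla_xi U X p : open U -> vector_field U X -> U p ->
  nablaN X xi p = - phi p (X p).
Proof.
move=> oU vX Up; have [tX _] := vX p Up; have tx := tangent_xi p.
have cn := lc_connection (nablaNP N).
have vx : vector_field U xi by apply: vector_field_sub (@xi_field _ _ N).
have tD := tangent_nabla (nablaNP N) _ _ _ _ oU vX vx Up.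
have := nabla_phi oU vX vx Up; rewrite /cov_deriv11.
rewrite (_ : (fun q => phi q (xi q)) = fun _ => 0); last first.
  by apply/funext => q; rewrite phi_xi.
rewrite (conn_zero _ _ _ cn oU vX Up) sub0r eta_xi scale1r.
move=> /(congr1 (phi p)); rewrite phiN; last exact: tangent_phi.
rewrite phi_phi// phi_lin//; last exact: tangentN.
rewrite phi_xi scaler0 add0r phiN// opprD opprK => e.
suff ex : eta p (nablaN X xi p) = 0 by move: e; rewrite ex scale0r subr0.
have := lc_metric (nablaNP N) oU vX vx vx Up.
rewrite (gC _ _ _ tx tD) -mulr2n metric_xi//.
rewrite (_ : (fun q => _) = cst 1); last first.
  by apply/funext => q; rewrite metric_xi ?eta_xi//; exact: tangent_xi.
rewrite (tangent_cst _ _ tX) => /esym/eqP.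
by rewrite mulrn_eq0 => /eqP.
Qed.

(** On commuting fields this is [exterior_derivative_dual] for [xi], where
    [nabla_X xi = - phi X]; the two terms agree because [phi] is skew. *)
Lemma exterior_derivative_eta d w1 w2 p : atlas d -> dom d p ->
  chart_field d w1 p (fun q => eta q (chart_field d w2 q)) -
  chart_field d w2 p (fun q => eta q (chart_field d w1 q)) =
  - (g p (phi p (chart_field d w1 p)) (chart_field d w2 p) *+ 2).
Proof.
move=> ad dp; have od := dom_open d.
have v1 := vector_field_chart d w1 ad; have v2 := vector_field_chart d w2 ad.
have [t1 _] := v1 p dp; have [t2 _] := v2 p dp.
have vx : vector_field (dom d) xi by apply: vector_field_sub (@xi_field _ _ N).
have := exterior_derivative_dual gC gL (nablaNP N) _ _ _ _ _ od v1 v2 vx dp.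
rewrite chart_field_bracket//; last first.
  exact: tangent_lie_bracket (nablaNP N) _ _ _ _ od v1 v2 dp.
rewrite (inner0l gL) ?subr0; last exact: tangent_xi.
have dE w w' : chart_field d w p (fun q => g q (chart_field d w' q) (xi q)) =
    chart_field d w p (fun q => eta q (chart_field d w' q)).
  apply: (tangent_ext (p := p)); first exact: tangent_chart_field.
  apply: filterS (near_dom d p dp) => q dq.
  by rewrite metric_xi//; exact: tangent_chart_field.
rewrite !dE => ->; rewrite (nabla_xi _ _ _ od v1 dp) (nabla_xi _ _ _ od v2 dp).
have tp1 := tangent_phi _ _ t1; have tp2 := tangent_phi _ _ t2.
rewrite !(innerNl gL)// (phi_skew p (chart_field d w2 p))// (gC _ _ _ t2 tp1).
by rewrite opprK mulr2n opprD.
Qed.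

End SasakianIdentities.

(** * The tangential part of phi on a submanifold *)

Section Submanifold.
Context {R : realType} {m k : nat} {N : sasakian R m} {M : submanifold N k}.
Implicit Types (p : M) (u v z : (M -> R) -> R^o).
Local Notation i := (@Defs.incl _ _ _ _ M).
Local Notation g := (@metric _ _ N).
Local Notation xi := (@xi _ _ N).
Local Notation eta := (@Defs.eta _ _ N).
Local Notation gM := (induced_metric i).
Local Notation P := (@opP _ _ _ _ M).

Lemma incl_smooth : smooth_map i.
Proof. by have [] := @incl_immersion _ _ _ _ M. Qed.

Lemma induced_metricC p u v : tangent p u -> tangent p v -> gM p u v = gM p v u.
Proof.
have [gC _ _ _] := metricP N => tu tv.
by apply: gC; apply: tangent_differential => //; exact: incl_smooth.
Qed.

Lemma induced_metric_lin p a u v w :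
  tangent p u -> tangent p v -> tangent p w ->
  gM p (a *: u + v) w = a * gM p u w + gM p v w.
Proof.
have [_ gL _ _] := metricP N => tu tv tw.
rewrite /induced_metric differential_lin gL//;
  by apply: tangent_differential => //; exact: incl_smooth.
Qed.

Lemma induced_metric_eq0 p u : tangent p u -> gM p u u = 0 -> u = 0.
Proof.
move=> tu; have ti := tangent_differential incl_smooth p u tu.
move=> /(metric_eq0 _ _ ti) => d0.
have [_ inj] := @incl_immersion _ _ _ _ M.
by apply: (inj p) => //; [exact: tangent0|rewrite d0 differential0].
Qed.

(** The difference between [phi u] and [P u] is the normal part of [phi u]. *)
Lemma metric_opP p u v : tangent p u -> tangent p v ->
  gM p (P p u) v = g (i p) (phiM p u) (differential i p v).
Proof.
move=> tu tv; have [gC gL _ _] := metricP N.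
have [tF nF] := opF_normal tu.
have tdv := tangent_differential incl_smooth p v tv.
have tP := tangent_differential incl_smooth p _ (opP_tangent tu).
by rewrite /phiM (phi_split tu) (innerDl gL)// nF// addr0.
Qed.

Lemma opP_skew p u v : tangent p u -> tangent p v ->
  gM p (P p u) v = - gM p u (P p v).
Proof.
move=> tu tv; have [gC gL _ _] := metricP N.
have tdv := tangent_differential incl_smooth p v tv.
have tdu := tangent_differential incl_smooth p u tu.
rewrite metric_opP// phi_skew// -[g _ _ (phi _ _)]gC//; last exact: tangent_phi.
by rewrite -[phi _ _]/(phiM p v) -metric_opP// induced_metricC//; exact: opP_tangent.
Qed.

Lemma opP_reeb p x : tangent p x -> differential i p x = xi (i p) -> P p x = 0.
Proof.
move=> tx dx; apply: (induced_metric_eq0 p); first exact: opP_tangent.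
rewrite metric_opP//; last exact: opP_tangent.
have [gC gL _ _] := metricP N.
rewrite /phiM dx phi_xi (inner0l gL)//.
by apply: tangent_differential; [exact: incl_smooth|exact: opP_tangent].
Qed.

Section Parallel.
Context {xiM : M -> (M -> R) -> R^o}.
Hypothesis vxi : vector_field setT xiM.
Hypothesis dxi : forall p, differential i p (xiM p) = xi (i p).

(** Both sides are the exterior derivative of the restricted contact form, computed
    with the induced connection on the left, and by naturality from the ambient
    manifold on the right. *)
Lemma exterior_derivative_reeb (U : set M) X Y p : open U -> vector_field U X ->
  vector_field U Y -> U p ->
  gM p (nablaM X xiM p) (Y p) - gM p (nablaM Y xiM p) (X p) =
  - (gM p (P p (X p)) (Y p) *+ 2).
Proof.
move=> oU vX vY Up; have vx : vector_field U xiM by apply: vector_field_sub vxi.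
have [tX _] := vX p Up; have [tY _] := vY p Up.
rewrite -(exterior_derivative_dual induced_metricC induced_metric_lin
  (nablaMP M) _ _ _ _ _ oU vX vY vx Up).
have tb := tangent_lie_bracket (nablaMP M) _ _ _ _ oU vX vY Up.
have [d ad dp] := atlas_cover (i p).
have tdX := tangent_differential incl_smooth p _ tX.
have tdY := tangent_differential incl_smooth p _ tY.
have etaE q v : tangent q v ->
    gM q v (xiM q) = eta (i q) (differential i q v).
  move=> tv; rewrite /induced_metric dxi metric_xi//.
  exact: tangent_differential incl_smooth q v tv.
have nU : \forall q \near p, U q by apply: open_nbhs_nbhs.
have dE Z Z' : vector_field U Z -> vector_field U Z' ->
    Z p (fun q => gM q (Z' q) (xiM q)) =
    Z p (fun q => eta (i q) (differential i q (Z' q))).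
  move=> vZ vZ'; apply: (tangent_ext (p := p)); first by have [] := vZ p Up.
  by apply: filterS nU => q Uq; rewrite etaE//; have [] := vZ' q Uq.
rewrite !dE// etaE//.
rewrite (exterior_derivative_pullback incl_smooth (eta_form N) _ _ _ _ _ _ _
  oU vX vY Up tb ad dp (tangent_coordE d _ ad dp tdX)
  (tangent_coordE d _ ad dp tdY)).
by rewrite exterior_derivative_eta// -!tangent_coordE// metric_opP.
Qed.

(** Put [x = P z], [y = P x] and let [A], [B] be the covariant derivatives of
    the Reeb field along extensions of [x] and [y].  Parallelism gives
    [P A = P B = 0], so by skewness [A] is orthogonal to [y] and [B] to [x]; the
    formula for the exterior derivative leaves [y = 0], that is [P (P z) = 0]. *)
Lemma parallel_opP0 (U : set M) p z : open U -> U p ->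
  (forall (W : set M) X, open W -> W `<=` U -> vector_field W X -> W p ->
     P p (nablaM X xiM p) = 0) ->
  tangent p z -> P p z = 0.
Proof.
move=> oU Up PA tz; have [c ac cp] := atlas_cover p.
have [oW WU] : open (U `&` dom c) /\ U `&` dom c `<=` U.
  by split; [apply: openI => //; exact: dom_open|move=> ? []].
have Wp : (U `&` dom c) p by [].
have tx := opP_tangent tz; have ty := opP_tangent tx.
have [w1 w1E] := (tangent_chartP c p _ ac cp).1 tx.
have [w2 w2E] := (tangent_chartP c p _ ac cp).1 ty.
have vF (w : 'rV[R]_k) : vector_field (U `&` dom c) (chart_field c w).
  by apply: vector_field_sub (vector_field_chart c w ac) => ? [].
have orth (w : 'rV[R]_k) u : tangent p u ->
    gM p (nablaM (chart_field c w) xiM p) (P p u) = 0.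
  move=> tu.
  have tA : tangent p (nablaM (chart_field c w) xiM p).
    apply: (tangent_nabla (nablaMP M)) oW (vF w) _ Wp.
    exact: vector_field_sub vxi.
  apply: oppr_inj; rewrite -opP_skew// oppr0 (PA _ _ oW WU (vF w) Wp).
  by rewrite (inner0l induced_metric_lin).
have := exterior_derivative_reeb _ _ _ p oW (vF w1) (vF w2) Wp.
rewrite -w1E -w2E orth// orth// subrr => /esym/eqP.
rewrite oppr_eq0 mulrn_eq0 => /eqP /(induced_metric_eq0 _ _ ty) PP0.
apply: (induced_metric_eq0 p) => //.
by rewrite opP_skew// PP0 (inner0r induced_metricC induced_metric_lin)// oppr0.
Qed.

End Parallel.
End Submanifold.

(** * Partially totally real submanifolds *)

Section Parallel.
Context {R : realType} {m k : nat} {N : sasakian R m}.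
Context {M : ptr_submanifold N k}.

(** As [P] kills the Reeb field, the covariant derivative of [P] applied to that
    field is [- P (nabla_X xi)]. *)
Lemma parallel_on_opP0 (U : set M) p v : open U -> parallel_on U -> U p ->
  tangent p v -> opP p v = 0.
Proof.
move=> oU par Up tv; have [xiM vxi dxi] := xi_tangent M.
apply: (parallel_opP0 vxi dxi U p v oU Up) => // W X oW WU vX Wp.
have vx : vector_field W xiM by apply: vector_field_sub vxi.
have := par W X xiM p oW WU vX vx Wp; rewrite /cov_deriv11.
rewrite (_ : (fun q => opP q (xiM q)) = fun _ => 0); last first.
  apply/funext => q; apply: opP_reeb (dxi q).
  by have [] := vxi q I.
rewrite (conn_zero _ _ _ (lc_connection (nablaMP M)) oW vX Wp) sub0r.
by move=> /eqP; rewrite oppr_eq0 => /eqP.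
Qed.

End Parallel.

Theorem proposition5p11 (R : realType) (m k : nat) (N : sasakian R m)
    (M : ptr_submanifold N k) :
  (parallel_on (M := M) setT ->
     forall (p : M) (v : (M -> R) -> R^o),
       tangent p v -> etaM p v = 0 -> opP p v = 0) /\
  (forall U : set M, proper_on U -> ~ parallel_on U).
Proof.
split=> [par p v tv _|U [oU _ [nreal _ _ _]] par].
  exact: parallel_on_opP0 openT par I tv.
apply: nreal => p Up v [tv _ _].
rewrite /phiM (phi_split tv) (parallel_on_opP0 U p v oU par Up tv).
by rewrite differential0 add0r; exact: opF_normal.
Qed.
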